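(* Let $f_i:[0,1]\to[0,1]$ be defined by $f_i(x)=\rho_i x+t_i$, where $\rho_i\in(0,1)$ and $t_i\in[0,1)$ for $i=1,\ldots,k$. Suppose that $\max\{f_i(0),f_i(1)\}\le\max\{f_{i+1}(0),f_{i+1}(1)\}$ for $i=1,\dots,k-1$ and that $f_i(0,1)\cap f_j(0,1)=\emptyset$ for all $i\ne j$. Let $p=(p_1,\dots,p_k)$ and $q=(q_1,\dots,q_k)$ be probability vectors in $(0,1)^k$ such that, for $\mathcal{A}=\mathbb{R}^{\ge0}$ or $\mathcal{A}=\mathbb{R}^{\le0}$, $\sum_{i=1}^m(p_i-q_i)\in\mathcal{A}$ for every $m=1,\dots,k$. Then, with $f=(f_1,\dots,f_k)$, $$W_1\left(\mu^{(f,p)},\mu^{(f,q)}\right)=\left|\frac{\sum_{i}p_it_i}{1-\sum_i p_i\rho_i}-\frac{\sum_i q_it_i}{1-\sum_i q_i\rho_i}\right|.$$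
   Context: For a finite tuple $f=(f_1,\dots,f_k)$ of contractions of $[0,1]$ and a probability vector $p=(p_1,\dots,p_k)$, the stationary probability measure $\mu^{(f,p)}$ is the unique Borel probability measure $\mu$ on $[0,1]$ with $\mu(A)=\sum_{i=1}^k p_i\,\mu(f_i^{-1}(A))$ for all Borel sets $A$. The first Wasserstein distance is $W_1(\mu,\nu)=\inf\{\mathbb{E}|X-Y|:\mathrm{law}(X)=\mu,\ \mathrm{law}(Y)=\nu\}$. *)

(* Defs.v *)
From HB Require Import structures.
From mathcomp Require Import all_boot all_order all_algebra.
From mathcomp Require Import all_classical all_reals all_analysis.
Import Order.TTheory GRing.Theory Num.Theory.
Import numFieldNormedType.Exports.

Set Implicit Arguments.
Unset Strict Implicit.
Unset Printing Implicit Defensive.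

Local Open Scope classical_set_scope.
Local Open Scope ring_scope.

Definition prob_vector (R : realType) (k : nat) (p : 'I_k -> R) : Prop :=
  (forall i, 0 <= p i) /\ \sum_(i < k) p i = 1.

(* A Borel probability measure on [0,1] is represented by a Borel probability
   measure on R giving mass 1 to [0,1]. A self-map of [0,1] is represented by a
   function R -> R, of which only the restriction to [0,1] matters: the preimage
   of A under it is [0,1] `&` f @^-1` A. *)
Definition stationary (R : realType) (k : nat) (f : 'I_k -> R -> R)
    (p : 'I_k -> R) (mu : probability R R) : Prop :=
  mu `[0%R, 1%R]%classic = 1%E /\
  forall A : set R, measurable A -> A `<=` `[0, 1]%classic ->
    mu A = (\sum_(i < k) (p i)%:E * mu (`[0%R, 1%R]%classic `&` f i @^-1` A))%E.

(* Equality of laws is required on Borel sets only: the underlying functions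
   set R -> \bar R take irrelevant values on nonmeasurable sets. *)
Definition has_law (R : realType) d (T : measurableType d) (P : probability T R)
    (X : {RV P >-> R}) (mu : probability R R) : Prop :=
  forall A : set R, measurable A -> distribution P X A = mu A.

(* The infimum ranges over all pairs of random variables on a common, arbitrary
   probability space. *)
Definition wasserstein1 (R : realType)
    (mu nu : probability R R) : \bar R :=
  ereal_inf [set e | exists (d : measure_display) (T : measurableType d)
      (P : probability T R) (X Y : {RV P >-> R}),
    [/\ has_law X mu, has_law Y nu & e = ('E_P[fun w => `|X w - Y w|%R])%E]].

(* Main.v *)
Require Import Defs.
From HB Require Import structures.
From mathcomp Require Import all_boot all_order all_algebra.
From mathcomp Require Import all_classical all_reals all_analysis.
From mathcomp Require Import measurable_realfun ring lra.
Import Order.TTheory GRing.Theory Num.Theory.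
Import numFieldNormedType.Exports.

Set Implicit Arguments.
Unset Strict Implicit.
Unset Printing Implicit Defensive.

Local Open Scope classical_set_scope.
Local Open Scope ring_scope.

(** The means of the two measures give a lower bound for the distance, and the
monotonicity of the maps gives couplings that reach it in the limit.

Write g_i(x) = rho_i x + t_i. Stationarity says that mu is the mixture of the
images of mu under the g_i with weights p_i, so its mean m(mu) satisfies
m = (sum_i p_i rho_i) m + sum_i p_i t_i [absmoment_stationary]; the right-hand
side of the theorem is |m(mu) - m(nu)|. For every coupling (X, Y) of mu and nu,
E|X - Y| >= |m(mu) - m(nu)| by the triangle inequality
[coupling_lower_bound].

For the upper bound, let p have the larger partial sums, the other case being
symmetric. The ordering of the right endpoints and the disjointness of the open
images put the interval g_i([0,1]) to the left of g_j([0,1]) for i < j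
[affine_images_separated], and p, q have a coupling w on pairs of indices
carried by {i <= j} [monotone_weight]. If gamma is a coupling of mu and nu,
draw (x, y) from gamma and, independently, (i, j) from w: the law of
(g_i(x), g_j(y)) is again a coupling of mu and nu, by stationarity. Its excess
E max(x - y, 0) is at most r times that of gamma, where
r = sum_i p_i rho_i < 1: pairs i < j contribute nothing, pairs i > j do not
occur, and i = j contributes with the factor rho_i [excess_step]. Starting from
the product measure, the excess tends to 0 [small_excess_coupling], and
|x - y| = (y - x) + 2 max(x - y, 0) turns this into
E|X - Y| -> m(nu) - m(mu) [coupling_excess]. *)

(** * Finite mixtures of image measures *)

Section Mixture.
Local Open Scope ereal_scope.
Context d d' (T : measurableType d) (T' : measurableType d') (R : realType).
Variables (P : probability T R) (I : finType) (w : I -> R).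
Variable phi : I -> {mfun T >-> T'}.
Hypotheses (w_ge0 : forall i, (0 <= w i)%R) (w_sum1 : (\sum_i w i)%R = 1%R).

Let term (n : nat) : {measure set T' -> \bar R} :=
  if insub n is Some j then
    mscale (NngNum (w_ge0 (enum_val (j : 'I_#|I|))))
           (distribution P (phi (enum_val j)))
  else mzero.

(** The law of phi_i(x) where x has law P and the index i, independent of x, has
law w. *)
Definition mixture : set T' -> \bar R := msum term #|I|.

HB.instance Definition _ := Measure.on mixture.

Lemma mixtureE A : mixture A = \sum_i (w i)%:E * P (phi i @^-1` A).
Proof.
rewrite /mixture /msum (reindex _ (onW_bij _ (enum_val_bij I))).
by apply: eq_bigr => i _; rewrite /term valK.
Qed.

Let mixture_setT : mixture setT = 1.
Proof.
rewrite mixtureE -[RHS]/(1%R%:E) -w_sum1 -sumEFin; apply: eq_bigr => i _.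
by rewrite preimage_setT probability_setT mule1.
Qed.

HB.instance Definition _ :=
  Measure_isProbability.Build _ _ _ mixture mixture_setT.

Lemma ge0_integral_mixture (h : T' -> \bar R) :
  measurable_fun [set: T'] h -> (forall y, 0 <= h y) ->
  \int[mixture]_y h y = \sum_i (w i)%:E * \int[P]_x h (phi i x).
Proof.
move=> mh h0; rewrite ge0_integral_measure_sum//.
rewrite (reindex _ (onW_bij _ (enum_val_bij I))).
apply: eq_bigr => i _; rewrite /term valK ge0_integral_mscale//.
by rewrite ge0_integral_distribution.
Qed.

(** Packages [mixture] as a probability, so that its users need not carry the
proofs about the weights inside the measure. *)
Lemma exists_mixture : exists Q : probability T' R,
  (forall A, Q A = \sum_i (w i)%:E * P (phi i @^-1` A)) /\
  (forall h : T' -> \bar R,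
     measurable_fun [set: T'] h -> (forall y, 0 <= h y) ->
     \int[Q]_y h y = \sum_i (w i)%:E * \int[P]_x h (phi i x)).
Proof.
by exists mixture; split; [exact: mixtureE | exact: ge0_integral_mixture].
Qed.

End Mixture.

(** * Measurability of the maps *)

Definition affine (R : realType) (a b : R) (x : R) : R := a * x + b.

Lemma measurable_affine (R : realType) (a b : R) :
  measurable_fun [set: R] (affine a b).
Proof. by apply: measurable_funD => //; exact: measurable_funM. Qed.

HB.instance Definition _ (R : realType) (a b : R) :=
  isMeasurableFun.Build _ _ _ _ (affine a b) (measurable_affine a b).

(** The product map of two affine maps of the line. *)
Definition affine2 (R : realType) (a b c d : R) (z : R * R) : R * R :=
  (affine a b z.1, affine c d z.2).

Lemma measurable_affine2 (R : realType) (a b c d : R) :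
  measurable_fun [set: R * R] (affine2 a b c d).
Proof. by apply: measurable_fun_pair; exact: measurableT_comp. Qed.

HB.instance Definition _ (R : realType) (a b c d : R) :=
  isMeasurableFun.Build _ _ _ _ (affine2 a b c d) (measurable_affine2 a b c d).

(* The coordinates of the plane, as random variables. *)
HB.instance Definition _ (R : realType) :=
  isMeasurableFun.Build _ _ _ _ (@fst R R) (@measurable_fst _ _ R R).
HB.instance Definition _ (R : realType) :=
  isMeasurableFun.Build _ _ _ _ (@snd R R) (@measurable_snd _ _ R R).

Lemma measurable_EFin_norm (R : realType) d (T : measurableType d)
    (u : T -> R) :
  measurable_fun [set: T] u -> measurable_fun [set: T] (fun x => `|u x|%:E).
Proof. by move=> mu; apply/measurable_EFinP; exact: measurableT_comp. Qed.

(** * Laws and events of probability one *)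

Lemma ge0_integral_law (R : realType) d (T : measurableType d)
    (P : probability T R) (X : {RV P >-> R}) (mu : probability R R)
    (h : R -> \bar R) :
  has_law X mu -> measurable_fun [set: R] h -> (forall x, 0 <= h x)%E ->
  (\int[P]_w h (X w) = \int[mu]_x h x)%E.
Proof.
move=> Xmu mh h0; rewrite -(ge0_integral_distribution X)//.
by apply: eq_measure_integral => A mA _; exact: Xmu.
Qed.

Lemma ge0_le_integral_prob1 (R : realType) d (T : measurableType d)
    (P : probability T R) (A : set T) (f g : T -> \bar R) :
  measurable A -> P A = 1%E ->
  measurable_fun [set: T] f -> measurable_fun [set: T] g ->
  (forall x, 0 <= f x)%E -> (forall x, 0 <= g x)%E ->
  (forall x, A x -> f x <= g x)%E ->
  (\int[P]_x f x <= \int[P]_x g x)%E.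
Proof.
move=> mA PA mf mg f0 g0 fg; apply: ae_ge0_le_integral => //.
exists (~` A); split; first exact: measurableC.
- by transitivity (1 - P A)%E; [exact: probability_setC | rewrite PA subee].
- by move=> x /= nfg Ax; apply: nfg => _; exact: fg.
Qed.

Lemma prob1_setI (R : realType) d (T : measurableType d) (P : probability T R)
    (A B : set T) :
  measurable A -> measurable B -> P A = 1%E -> P (A `&` B) = P B.
Proof.
move=> mA mB PA; rewrite setIC -[RHS]adde0.
have -> : P B = (P (B `&` A) + P (B `\` A))%E by rewrite addeC -measureDI.
rewrite (_ : P (B `\` A) = 0%E) ?adde0//; apply/eqP.
rewrite eq_le measure_ge0 andbT.
apply: (@le_trans _ _ (P (~` A))).
  apply: le_measure; rewrite ?inE; [exact: measurableD|exact: measurableC|].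
  by move=> x [].
have -> : P (~` A) = (1 - P A)%E by exact: probability_setC.
by rewrite PA subee.
Qed.

Lemma absmoment_le1 (R : realType) (mu : probability R R) :
  mu `[0, 1]%classic = 1%E -> (\int[mu]_x `|x|%:E <= 1)%E.
Proof.
move=> mu01; apply: (@le_trans _ _ (\int[mu]_x cst 1%E x)%E).
  apply: (ge0_le_integral_prob1 (P := mu) (A := `[0, 1]%classic)) => //.
  - exact: (measurable_EFin_norm (@measurable_id _ R setT)).
  - by move=> x /=; rewrite in_itv/= lee_fin => /andP[x0 x1]; rewrite ger0_norm.
by rewrite integral_cst// mul1e; exact: probability_le1.
Qed.

(** * Couplings and the two bounds on their cost *)

(** Half of the lower bound; the other half comes from exchanging X and Y.
Absolute moments stand for the means, with which they agree for laws carried by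
[0,1], so that only nonnegative functions are integrated. *)
Lemma coupling_lower_bound (R : realType) d (T : measurableType d)
    (P : probability T R) (X Y : {RV P >-> R}) (mu nu : probability R R) :
  has_law X mu -> has_law Y nu ->
  (\int[nu]_y `|y|%:E <=
     'E_P[fun w => `|X w - Y w|%R] + \int[mu]_x `|x|%:E)%E.
Proof.
move=> Xmu Ynu.
have mX := measurable_EFin_norm (@measurable_funPT _ _ _ _ X).
have mY := measurable_EFin_norm (@measurable_funPT _ _ _ _ Y).
have mXY : measurable_fun [set: T] (fun w => `|X w - Y w|%:E).
  by apply: measurable_EFin_norm; exact: measurable_funB.
have mn := measurable_EFin_norm (@measurable_id _ R setT).
have n0 (x : R) : (0 <= `|x|%:E)%E by rewrite lee_fin.
rewrite -(ge0_integral_law Xmu mn n0).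
rewrite -(ge0_integral_law Ynu mn n0).
rewrite unlock -ge0_integralD//=.
apply: ge0_le_integral => //=.
- exact: emeasurable_funD.
- move=> x _; rewrite -EFinD lee_fin -[leLHS]normrN.
  by have := ler_normB (X x - Y x) (X x); rewrite addrAC subrr add0r.
Qed.

(** Couplings are taken as measures on the plane, the two random variables being
the coordinates. *)
Definition is_coupling (R : realType) (mu nu : probability R R)
    (g : probability (R * R)%type R) : Prop :=
  has_law (fst : {RV g >-> R}) mu /\ has_law (snd : {RV g >-> R}) nu.

Definition unit_square (R : realType) : set (R * R) :=
  fst @^-1` `[0, 1]%classic `&` snd @^-1` `[0, 1]%classic.

Lemma measurable_unit_square (R : realType) : measurable (@unit_square R).
Proof.
apply: measurableI; rewrite -[X in measurable X]setTI;
  [exact: measurable_fst | exact: measurable_snd].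
Qed.

Lemma coupling_unit_square (R : realType) (mu nu : probability R R)
    (g : probability (R * R)%type R) :
  mu `[0, 1]%classic = 1%E -> nu `[0, 1]%classic = 1%E ->
  is_coupling mu nu g -> g (@unit_square R) = 1%E.
Proof.
move=> mu01 nu01 [g1 g2].
have mfst : measurable (fst @^-1` `[0, 1] : set (R * R)).
  by rewrite -[X in measurable X]setTI; exact: measurable_fst.
have msnd : measurable (snd @^-1` `[0, 1] : set (R * R)).
  by rewrite -[X in measurable X]setTI; exact: measurable_snd.
rewrite prob1_setI//; first by rewrite -nu01; exact: g2.
by rewrite -mu01; exact: g1.
Qed.

(** The amount by which a pair fails to be ordered. *)
Definition excess (R : realType) (z : R * R) : \bar R :=
  (Num.max (z.1 - z.2) 0)%:E.

Lemma excess_ge0 (R : realType) (z : R * R) : (0 <= excess z)%E.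
Proof. by rewrite lee_fin le_max lexx orbT. Qed.

Lemma measurable_excess (R : realType) :
  measurable_fun [set: R * R] (@excess R).
Proof.
by apply/measurable_EFinP; apply: measurable_maxr => //; exact: measurable_funB.
Qed.

Lemma is_coupling_product (R : realType) (mu nu : probability R R) :
  is_coupling mu nu (mu \x nu)%E.
Proof.
split=> A mA; rewrite /distribution /pushforward.
- rewrite -setXT; transitivity (mu A * nu setT)%E.
    exact: product_measure1E.
  by rewrite probability_setT mule1.
- rewrite -setTX; transitivity (mu setT * nu A)%E.
    exact: product_measure1E.
  by rewrite probability_setT mul1e.
Qed.

Lemma excess_le2 (R : realType) (mu nu : probability R R)
    (g : probability (R * R)%type R) :
  mu `[0, 1]%classic = 1%E -> nu `[0, 1]%classic = 1%E ->
  is_coupling mu nu g -> (\int[g]_z excess z <= 2%:E)%E.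
Proof.
move=> mu01 nu01 [g1 g2].
have mE := @measurable_excess R; have E0 := @excess_ge0 R.
have mX := measurable_EFin_norm (@measurable_fst _ _ R R).
have mY := measurable_EFin_norm (@measurable_snd _ _ R R).
have mn := measurable_EFin_norm (@measurable_id _ R setT).
have n0 (x : R) : (0 <= `|x|%:E)%E by rewrite lee_fin.
apply: (@le_trans _ _ (\int[g]_z (`|z.1|%:E + `|z.2|%:E))%E).
  apply: ge0_le_integral => //=; first exact: emeasurable_funD.
  move=> [x y] _; rewrite /excess/= -EFinD lee_fin ge_max addr_ge0// andbT.
  by rewrite (le_trans (ler_norm _))// ler_normB.
rewrite ge0_integralD//=.
rewrite (ge0_integral_law g1 mn n0).
rewrite (ge0_integral_law g2 mn n0).
rewrite (_ : 2%:E = 1 + 1)%E; last by rewrite -EFinD.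
by apply: leeD; exact: absmoment_le1.
Qed.

(** Integrated form of |x - y| + x <= y + 2 max(x - y, 0), which holds for x, y
in [0,1] and is in fact an equality there. *)
Lemma coupling_excess (R : realType) (mu nu : probability R R)
    (g : probability (R * R)%type R) :
  mu `[0, 1]%classic = 1%E -> nu `[0, 1]%classic = 1%E ->
  is_coupling mu nu g ->
  ('E_g[fun z => `|z.1 - z.2|%R] + \int[mu]_x `|x|%:E <=
   \int[nu]_y `|y|%:E + 2%:E * \int[g]_z excess z)%E.
Proof.
move=> mu01 nu01 gc; have [g1 g2] := gc.
have mB : measurable_fun [set: R * R] (fun z => z.1 - z.2).
  exact: measurable_funB.
have mX := measurable_EFin_norm (@measurable_fst _ _ R R).
have mY := measurable_EFin_norm (@measurable_snd _ _ R R).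
have mXY := measurable_EFin_norm mB.
have mE := @measurable_excess R; have E0 := @excess_ge0 R.
have mn := measurable_EFin_norm (@measurable_id _ R setT).
have n0 (x : R) : (0 <= `|x|%:E)%E by rewrite lee_fin.
rewrite -(ge0_integral_law g1 mn n0) -(ge0_integral_law g2 mn n0).
have two0 : (0 <= 2%:E :> \bar R)%E by rewrite lee_fin.
have m2E : measurable_fun [set: R * R] (fun z => 2%:E * excess z)%E.
  exact: emeasurable_funM.
rewrite unlock -ge0_integralZl// -!ge0_integralD//=; last first.
  by move=> z _; rewrite mule_ge0.
apply: (ge0_le_integral_prob1 (A := @unit_square R)) => //=.
- exact: measurable_unit_square.
- exact: coupling_unit_square gc.
- exact: emeasurable_funD.
- exact: emeasurable_funD.
- by move=> z; rewrite adde_ge0.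
- by move=> z; rewrite adde_ge0// mule_ge0.
- move=> [x y] /= [] /=; rewrite !in_itv/= => /andP[x0 x1] /andP[y0 y1].
  rewrite -EFinM -!EFinD lee_fin (ger0_norm x0) (ger0_norm y0).
  by case: (leP (x - y) 0) => xy; [rewrite ler0_norm|rewrite gtr0_norm]; lra.
Qed.

(** * The monotone coupling of two probability vectors *)

Section MonotoneCoupling.
Context (R : realType) (k : nat) (p q : 'I_k -> R).

(** Distribution function of a vector: the sum of its first m entries. *)
Definition psum (u : 'I_k -> R) (m : nat) : R := \sum_(i < k | (i < m)%N) u i.

Lemma psum0 u : psum u 0 = 0.
Proof. by rewrite /psum big_pred0. Qed.

Lemma psumS u (i : 'I_k) : psum u i.+1 = psum u i + u i.
Proof.
rewrite /psum (bigD1 i)//= addrC; congr (_ + _); apply: eq_bigl => j.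
by rewrite ltnS [in RHS]ltn_neqAle andbC.
Qed.

Lemma psumT u : psum u k = \sum_i u i.
Proof. by apply: eq_bigl => i; rewrite ltn_ord. Qed.

Lemma psum_homo u (m n : nat) : (forall i, 0 <= u i) -> (m <= n)%N ->
  psum u m <= psum u n.
Proof.
move=> u0 mn; rewrite /psum big_mkcond [leRHS]big_mkcond; apply: ler_sum => i _.
by case: ifPn => [im|_]; [rewrite (leq_trans im)|case: ifP].
Qed.

(** Joint weights whose distribution function is min(psum p, psum q): the weight of
(i, j) is the increment over that cell, that is, for probability vectors, the
length of the overlap of the i-th interval of the subdivision of [0,1] given by
p with the j-th one given by q. *)
Definition monotone_weight (ij : 'I_k * 'I_k) : R :=
  Num.min (psum p ij.1.+1) (psum q ij.2.+1)
  - Num.min (psum p ij.1) (psum q ij.2.+1)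
  - (Num.min (psum p ij.1.+1) (psum q ij.2)
     - Num.min (psum p ij.1) (psum q ij.2)).

Hypotheses (p0 : forall i, 0 <= p i) (q0 : forall i, 0 <= q i).
Hypotheses (p1 : \sum_i p i = 1) (q1 : \sum_i q i = 1).

Let psum_ge0 u m : (forall i, 0 <= u i) -> 0 <= psum u m.
Proof. by move=> u0; exact: sumr_ge0. Qed.

Let psum_le1 u m : (forall i, 0 <= u i) -> \sum_i u i = 1 -> psum u m <= 1.
Proof.
move=> u0 <-; rewrite /psum big_mkcond; apply: ler_sum => i _.
by case: ifP.
Qed.

Lemma monotone_weight_ge0 ij : 0 <= monotone_weight ij.
Proof.
case: ij => i j; rewrite /monotone_weight/= !psumS.
have := p0 i; have := q0 j; rewrite !minEle.
by do 4!case: ifP => /idP; move=> *; lra.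
Qed.

Lemma sum_monotone_weight_r i : \sum_j monotone_weight (i, j) = p i.
Proof.
rewrite (eq_bigr (fun j : 'I_k =>
  (Num.min (psum p i.+1) (psum q j.+1) - Num.min (psum p i) (psum q j.+1)) -
  (Num.min (psum p i.+1) (psum q j) - Num.min (psum p i) (psum q j))))//.
rewrite -(big_mkord xpredT (fun j =>
  (Num.min (psum p i.+1) (psum q j.+1) - Num.min (psum p i) (psum q j.+1)) -
  (Num.min (psum p i.+1) (psum q j) - Num.min (psum p i) (psum q j)))).
rewrite (telescope_sumr (fun j =>
  Num.min (psum p i.+1) (psum q j) - Num.min (psum p i) (psum q j)))//.
rewrite psumT q1 psum0.
rewrite 2?(min_l (psum_le1 _ p0 p1)) 2?(min_r (psum_ge0 _ p0)).
by rewrite psumS subrr subr0 addrAC subrr add0r.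
Qed.

Lemma sum_monotone_weight_l j : \sum_i monotone_weight (i, j) = q j.
Proof.
rewrite (eq_bigr (fun i : 'I_k =>
  (Num.min (psum p i.+1) (psum q j.+1) - Num.min (psum p i.+1) (psum q j)) -
  (Num.min (psum p i) (psum q j.+1) - Num.min (psum p i) (psum q j))));
    last first.
  by move=> i _; rewrite /monotone_weight/=; ring.
rewrite -(big_mkord xpredT (fun i =>
  (Num.min (psum p i.+1) (psum q j.+1) - Num.min (psum p i.+1) (psum q j)) -
  (Num.min (psum p i) (psum q j.+1) - Num.min (psum p i) (psum q j)))).
rewrite (telescope_sumr (fun i =>
  Num.min (psum p i) (psum q j.+1) - Num.min (psum p i) (psum q j)))//.
rewrite psumT p1 psum0.
rewrite 2?(min_r (psum_le1 _ q0 q1)) 2?(min_l (psum_ge0 _ q0)).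
by rewrite psumS subrr subr0 addrAC subrr add0r.
Qed.

Lemma sum_monotone_weight : \sum_ij monotone_weight ij = 1.
Proof.
transitivity (\sum_i \sum_j monotone_weight (i, j)).
  by rewrite pair_big; apply: eq_bigr => -[].
by under eq_bigr do rewrite sum_monotone_weight_r.
Qed.

(** When the partial sums of p dominate those of q, for j < i the i-th interval of
p does not start before the j-th interval of q ends. *)
Lemma monotone_weight_eq0 (i j : 'I_k) :
  (forall m : nat, psum q m <= psum p m) -> (j < i)%N ->
  monotone_weight (i, j) = 0.
Proof.
move=> qp ji; rewrite /monotone_weight/=.
have qj : psum q j <= psum q j.+1 by exact: psum_homo.
have qi : psum q j.+1 <= psum p i.
  by apply: (le_trans (qp _)); exact: psum_homo.
have pi : psum p i <= psum p i.+1 by exact: psum_homo.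
rewrite !min_r//; first by ring.
all: by rewrite ?(le_trans qj)// ?(le_trans qi).
Qed.

End MonotoneCoupling.

(** * Stationary measures of affine maps and their means *)

Section AffineIFS.
Context (R : realType) (k : nat) (rho t : 'I_k -> R) (f : 'I_k -> R -> R).
Hypotheses (hrho : forall i, 0 < rho i < 1) (ht : forall i, 0 <= t i < 1).
Hypothesis hf01 : forall i, set_fun `[0, 1]%classic `[0, 1]%classic (f i).
Hypothesis hf : forall i x, 0 <= x <= 1 -> f i x = rho i * x + t i.

Let phi i : {mfun R >-> R} := affine (rho i) (t i).

(** Replaces f_i, which may be nonmeasurable outside [0,1], by the affine
map of the whole line that agrees with it on [0,1]; since mu is carried by
[0,1], neither A nor the preimages need be cut down to [0,1]. *)
Lemma stationary_affine (p : 'I_k -> R) (mu : probability R R) (A : set R) :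
  stationary f p mu -> measurable A ->
  mu A = (\sum_i (p i)%:E * mu (phi i @^-1` A))%E.
Proof.
move=> [mu01 muE] mA.
have m01 : measurable (`[0, 1]%classic : set R) by exact: measurable_itv.
rewrite -(prob1_setI (P := mu) (A := `[0, 1]%classic) (B := A))//.
rewrite muE; [|exact: measurableI|by move=> x []].
apply: eq_bigr => i _; congr (_ * _)%E.
rewrite -[RHS](prob1_setI (P := mu) (A := `[0, 1]%classic))//; last first.
  by rewrite -[X in measurable X]setTI; exact: measurable_affine.
congr (mu _); apply/seteqP; split=> x [x01] /=; rewrite /affine => fx.
- by split=> //; case: fx => _; rewrite hf.
- by split=> //; split; [exact: hf01 | rewrite hf].
Qed.

Lemma mean_ratio_lt1 (p : 'I_k -> R) : prob_vector p ->
  \sum_i p i * rho i < 1.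
Proof.
move=> [p0 p1]; rewrite -subr_gt0 -{1}p1 -sumrB lt_def; apply/andP; split.
  apply/eqP => s0.
  have z i : p i - p i * rho i = 0.
    move: s0 => /eqP; rewrite psumr_eq0 => [/allP/(_ i)|j _].
      by rewrite mem_index_enum => /(_ isT) /eqP.
    by have /andP[_ r1] := hrho j; rewrite subr_ge0 ler_piMr// ltW.
  have : \sum_i p i = 0.
    apply: big1 => i _; apply/eqP; have /eqP := z i.
    rewrite -{1}[p i]mulr1 -mulrBr mulf_eq0 => /orP[//|].
    by have /andP[_ r1] := hrho i; rewrite subr_eq0 gt_eqF.
  by rewrite p1 => /eqP; rewrite oner_eq0.
apply: sumr_ge0 => i _; have /andP[_ r1] := hrho i.
by rewrite subr_ge0 ler_piMr// ltW.
Qed.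

Lemma absmoment_stationary (p : 'I_k -> R) (mu : probability R R) :
  prob_vector p -> stationary f p mu ->
  (\int[mu]_x `|x|%:E =
    ((\sum_i p i * t i) / (1 - \sum_i p i * rho i))%:E)%E.
Proof.
move=> hp hmu; have [p0 p1] := hp; have mu01 := hmu.1.
have mn := measurable_EFin_norm (@measurable_id _ R setT).
have n0 (x : R) : (0 <= `|x|%:E)%E by rewrite lee_fin.
have I0 : (0 <= \int[mu]_x `|x|%:E)%E by exact: integral_ge0.
have I1 := absmoment_le1 mu01.
have Ifin : (\int[mu]_x `|x|%:E)%E \is a fin_num.
  by rewrite ge0_fin_numE// (le_lt_trans I1)// ltry.
(* The linear equation that the mean inherits from stationarity. *)
have : (\int[mu]_x `|x|%:E =
    \sum_i (p i)%:E * ((rho i)%:E * \int[mu]_x `|x|%:E + (t i)%:E))%E.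
  have [Q [QE Qint]] := exists_mixture mu phi p0 p1.
  transitivity (\int[Q]_x `|x|%:E)%E.
    apply: eq_measure_integral => A mA _.
    transitivity (\sum_i (p i)%:E * mu (phi i @^-1` A))%E.
      exact: stationary_affine.
    by apply/esym; exact: QE.
  rewrite Qint//; apply: eq_bigr => i _; congr (_ * _)%E.
  have /andP[r0 _] := hrho i; have /andP[t0 _] := ht i.
  have mr : measurable_fun [set: R] (fun x : R => (rho i)%:E * `|x|%:E)%E.
    exact: emeasurable_funM.
  transitivity (\int[mu]_x ((rho i)%:E * `|x|%:E + (t i)%:E))%E.
    have ma : measurable_fun [set: R] (fun x : R => `|phi i x|%:E).
      apply: (@measurable_EFin_norm _ _ _ (phi i)); exact: measurable_affine.
    have mc : measurable_fun [set: R]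
        (fun x : R => (rho i)%:E * `|x|%:E + (t i)%:E)%E.
      exact: emeasurable_funD.
    have c0 (x : R) : (0 <= (rho i)%:E * `|x|%:E + (t i)%:E)%E.
      by rewrite adde_ge0// ?mule_ge0// lee_fin ltW.
    have E (x : R) : `[0, 1]%classic x ->
        (`|phi i x|%:E = (rho i)%:E * `|x|%:E + (t i)%:E)%E.
      rewrite /= in_itv/= => /andP[x0 x1].
      rewrite -EFinM -EFinD (ger0_norm x0) ger0_norm//.
      by rewrite addr_ge0// mulr_ge0// ltW.
    apply/eqP; rewrite eq_le; apply/andP; split;
      apply: (ge0_le_integral_prob1 (P := mu) (A := `[0, 1]%classic)) => //;
      by move=> x /E ->.
  rewrite ge0_integralD//.
  - rewrite ge0_integralZl// ?lee_fin ?ltW//; congr (_ + _)%E.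
    transitivity ((t i)%:E * mu setT)%E; first exact: integral_cst.
    by rewrite probability_setT mule1.
  - by move=> x _; rewrite mule_ge0// lee_fin ltW.
have /andP[r0 r1] : 0 <= \sum_i p i * rho i < 1.
  rewrite mean_ratio_lt1// andbT sumr_ge0// => i _.
  by have /andP[r0 _] := hrho i; rewrite mulr_ge0// ltW.
rewrite -(fineK Ifin); set m := fine _ => E; congr (_%:E).
have : m = (\sum_i p i * rho i) * m + \sum_i p i * t i.
  apply: EFin_inj; rewrite [LHS]E mulr_suml -big_split/= -sumEFin.
  by apply: eq_bigr => i _; rewrite -EFinM mulrDr mulrA.
move=> mE; apply: (@mulIf _ (1 - \sum_i p i * rho i)).
  by rewrite subr_eq0 gt_eqF.
rewrite divfK ?subr_eq0 ?gt_eqF// mulrBr mulr1 {1}mE; ring.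
Qed.

End AffineIFS.

(** * Couplings with small excess *)

Section CouplingIteration.
Context (R : realType) (k : nat) (rho t : 'I_k -> R) (f : 'I_k -> R -> R).
Context (p q : 'I_k -> R) (mu nu : probability R R).
Hypothesis hrho : forall i, 0 < rho i < 1.
Hypothesis hf01 : forall i, set_fun `[0, 1]%classic `[0, 1]%classic (f i).
Hypothesis hf : forall i x, 0 <= x <= 1 -> f i x = rho i * x + t i.
Hypotheses (hp : prob_vector p) (hq : prob_vector q).
Hypotheses (hmu : stationary f p mu) (hnu : stationary f q nu).
Hypothesis qp : forall m : nat, psum q m <= psum p m.
Hypothesis sep : forall i j : 'I_k, (i < j)%N -> rho i + t i <= t j.

Let w := monotone_weight p q.
Let w_ge0 : forall ij, 0 <= w ij.
Proof. exact: (monotone_weight_ge0 hp.1 hq.1). Qed.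
Let w_sum1 : \sum_ij w ij = 1.
Proof. exact: (sum_monotone_weight hp.1 hp.2 hq.2). Qed.

Let step_map (ij : 'I_k * 'I_k) : {mfun (R * R)%type >-> (R * R)%type} :=
  affine2 (rho ij.1) (t ij.1) (rho ij.2) (t ij.2).

(** A mixture of images of a coupling under the product maps g_i x g_j is again
a coupling, since w has marginals p and q. *)
Lemma is_coupling_step (g g' : probability (R * R)%type R) :
  (forall A, g' A = \sum_ij (w ij)%:E * g (step_map ij @^-1` A))%E ->
  is_coupling mu nu g -> is_coupling mu nu g'.
Proof.
move=> g'E [g1 g2]; split=> A mA.
- transitivity (\sum_ij (w ij)%:E * g (step_map ij @^-1` (fst @^-1` A)))%E.
    exact: g'E.
  transitivity (\sum_i (p i)%:E * mu (affine (rho i) (t i) @^-1` A))%E;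
    last first.
    by apply/esym; exact: (stationary_affine hf01 hf).
  transitivity (\sum_i \sum_j
      (w (i, j))%:E * mu (affine (rho i) (t i) @^-1` A))%E.
    rewrite pair_big; apply: eq_bigr => -[i j] _; congr (_ * _)%E.
    apply: (g1 (affine (rho i) (t i) @^-1` A)).
    by rewrite -[X in measurable X]setTI; exact: measurable_affine.
  apply: eq_bigr => i _; rewrite -ge0_sume_distrl; last first.
    by move=> j _; rewrite lee_fin.
  by rewrite sumEFin (sum_monotone_weight_r hp.1 hp.2 hq.2).
- transitivity (\sum_ij (w ij)%:E * g (step_map ij @^-1` (snd @^-1` A)))%E.
    exact: g'E.
  transitivity (\sum_i (q i)%:E * nu (affine (rho i) (t i) @^-1` A))%E;
    last first.
    by apply/esym; exact: (stationary_affine hf01 hf).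
  transitivity (\sum_i \sum_j
      (w (i, j))%:E * nu (affine (rho j) (t j) @^-1` A))%E.
    rewrite pair_big; apply: eq_bigr => -[i j] _; congr (_ * _)%E.
    apply: (g2 (affine (rho j) (t j) @^-1` A)).
    by rewrite -[X in measurable X]setTI; exact: measurable_affine.
  rewrite exchange_big; apply: eq_bigr => j _.
  rewrite -ge0_sume_distrl; last by move=> i _; rewrite lee_fin.
  by rewrite sumEFin (sum_monotone_weight_l hq.1 hp.2 hq.2).
Qed.

(** Pairs i < j contribute nothing because [sep] orders the images, pairs j < i
have weight zero, and w(i, i) <= p_i bounds the diagonal. *)
Lemma excess_step (g g' : probability (R * R)%type R) (c : R) :
  (\int[g']_z excess z =
    \sum_ij (w ij)%:E * \int[g]_z excess (step_map ij z))%E ->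
  0 <= c -> is_coupling mu nu g ->
  (\int[g]_z excess z <= c%:E)%E ->
  (\int[g']_z excess z <= ((\sum_i p i * rho i) * c)%:E)%E.
Proof.
move=> g'E c0 gc gC.
have mE := @measurable_excess R; have E0 := @excess_ge0 R.
have term_le (i j : 'I_k) :
  ((w (i, j))%:E * \int[g]_z excess (step_map (i, j) z) <=
   (if i == j then w (i, j) * (rho i * c) else 0)%:E)%E.
  case: ifPn => [/eqP <-|ij].
    rewrite EFinM lee_wpmul2l ?lee_fin//.
    have /andP[r0 _] := hrho i.
    apply: (@le_trans _ _ (\int[g]_z ((rho i)%:E * excess z))%E).
      apply: ge0_le_integral => //.
      - by apply: measurableT_comp => //; exact: measurable_affine2.
      - exact: emeasurable_funM.
      - move=> [x y] _; rewrite /excess /step_map /affine2 /affine/= -EFinM.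
        rewrite lee_fin /affine.
        case: (leP (x - y) 0) => xy; rewrite ge_max.
          by rewrite mulr0 lexx andbT; have := ler_wpM2l (ltW r0) xy; lra.
        by apply/andP; split; [lra | rewrite mulr_ge0// ltW].
    rewrite ge0_integralZl//; last by rewrite lee_fin ltW.
    by rewrite EFinM lee_wpmul2l// lee_fin ltW.
  have [ji|ij'] := ltnP j i.
    by rewrite /w monotone_weight_eq0 ?mul0e//; [exact: hp.1|exact: hq.1].
  have {ij ij'}ij : (i < j)%N by rewrite ltn_neqAle ij.
  rewrite -[leRHS](mule0 (w (i, j))%:E) lee_wpmul2l ?lee_fin//.
  rewrite -[leRHS](integral0 g setT).
  apply: (ge0_le_integral_prob1 (P := g) (A := @unit_square R)) => //.
  - exact: measurable_unit_square.
  - by apply: coupling_unit_square gc; [exact: hmu.1 | exact: hnu.1].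
  - by apply: measurableT_comp => //; exact: measurable_affine2.
  - move=> [x y] []/=; rewrite !in_itv/= => /andP[x0 x1] /andP[y0 y1].
    rewrite /excess lee_fin ge_max lexx andbT /step_map /affine2 /= /affine.
    have /andP[ri _] := hrho i; have /andP[rj _] := hrho j; have sij := sep ij.
    have : rho i * x <= rho i by rewrite ler_piMr// ltW.
    have : 0 <= rho j * y by rewrite mulr_ge0// ltW.
    lra.
rewrite g'E.
apply: (@le_trans _ _
  (\sum_i \sum_j (if i == j then w (i, j) * (rho i * c) else 0)%:E)%E).
  by rewrite pair_big; apply: lee_sum => -[i j] _; exact: term_le.
under eq_bigr do rewrite sumEFin.
rewrite sumEFin lee_fin mulr_suml; apply: ler_sum => i _.
rewrite -big_mkcond (big_pred1 i) => [|j]; last by rewrite eq_sym.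
rewrite -mulrA ler_wpM2r//.
  by have /andP[r0 _] := hrho i; rewrite mulr_ge0// ltW.
rewrite -(sum_monotone_weight_r hp.1 hp.2 hq.2 i) (bigD1 i)//= lerDl.
by apply: sumr_ge0 => j _; exact: w_ge0.
Qed.

Lemma small_excess_coupling n : exists2 g, is_coupling mu nu g &
  (\int[g]_z excess z <= (2 * (\sum_i p i * rho i) ^+ n)%:E)%E.
Proof.
elim: n => [|n [g gc gle]].
  exists (mu \x nu)%E; first exact: is_coupling_product.
  by rewrite expr0 mulr1; apply: excess_le2 (is_coupling_product _ _);
    [exact: hmu.1 | exact: hnu.1].
have [g' [g'E g'int]] := exists_mixture g step_map w_ge0 w_sum1.
exists g'; first exact: is_coupling_step g'E gc.
rewrite exprS mulrCA; apply: (excess_step (g := g)) => //.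
  by apply: g'int; [exact: measurable_excess | exact: excess_ge0].
apply: mulr_ge0 => //; apply: exprn_ge0; apply: sumr_ge0 => i _.
by have /andP[r0 _] := hrho i; apply: mulr_ge0; [exact: hp.1 | exact: ltW].
Qed.

End CouplingIteration.

(** * The distance *)

Lemma wasserstein1_sym (R : realType) (mu nu : probability R R) :
  wasserstein1 mu nu = wasserstein1 nu mu.
Proof.
have swap_le (m n : probability R R) : (wasserstein1 m n <= wasserstein1 n m)%E.
  apply: ereal_inf_le_tmp => _ [d [T [P [X [Y [Xm Yn ->]]]]]].
  exists d, T, P, Y, X; split=> //; congr ('E_P[ _ ])%E.
  by apply/funext => x; rewrite distrC.
by apply/eqP; rewrite eq_le !swap_le.
Qed.

Lemma wasserstein1_ge (R : realType) (mu nu : probability R R) (a b : R) :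
  (\int[mu]_x `|x|%:E = a%:E)%E -> (\int[nu]_x `|x|%:E = b%:E)%E ->
  ((b - a)%:E <= wasserstein1 mu nu)%E.
Proof.
move=> ma nb; apply: le_ereal_inf_tmp => _ [d [T [P [X [Y [Xm Yn ->]]]]]].
by have := coupling_lower_bound Xm Yn; rewrite ma nb EFinB leeBlDr.
Qed.

(** The open images are the intervals ]t_i, t_i + rho_i[, with right endpoints
nondecreasing in i; were t_j < t_i + rho_i for some i < j, the midpoint of
max(t_i, t_j) and t_i + rho_i would lie in both. *)
Lemma affine_images_separated (R : realType) (k : nat) (rho t : 'I_k -> R)
    (f : 'I_k -> R -> R)
    (hrho : forall i, 0 < rho i < 1)
    (hf : forall i x, 0 <= x <= 1 -> f i x = rho i * x + t i)
    (hord : forall i j : 'I_k, (j : nat) = i.+1 ->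
      Num.max (f i 0) (f i 1) <= Num.max (f j 0) (f j 1))
    (hdisj : forall i j : 'I_k, i != j ->
      f i @` `]0, 1[%classic `&` f j @` `]0, 1[%classic = set0)
    (i j : 'I_k) : (i < j)%N -> rho i + t i <= t j.
Proof.
have f1 l : Num.max (f l 0) (f l 1) = rho l + t l.
  rewrite !hf ?lexx ?ler01// mulr0 mulr1 add0r max_r// lerDr.
  by have /andP[/ltW] := hrho l.
have top_homo (n : nat) (a b : 'I_k) : (b : nat) = (a + n)%N ->
    rho a + t a <= rho b + t b.
  elim: n b => [|n IHn] b ban.
    by rewrite (_ : b = a)//; apply: val_inj; rewrite /= ban addn0.
  have ank : (a + n < k)%N by rewrite (leq_trans _ (ltn_ord b))// ban addnS.
  apply: (le_trans (IHn (Ordinal ank) erefl)).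
  by rewrite -!f1; apply: hord; rewrite ban addnS.
move=> ij; rewrite leNgt; apply/negP => tji.
have hij : rho i + t i <= rho j + t j.
  by apply: (top_homo (j - i)%N); rewrite subnKC// ltnW.
have /andP[ri0 _] := hrho i; have /andP[rj0 _] := hrho j.
pose y := (Num.max (t i) (t j) + (rho i + t i)) / 2.
have [yi yj yt] : [/\ t i < y, t j < y & y < rho i + t i].
  by rewrite /y; case: (leP (t i) (t j)) => tt; split; lra.
have mem l : t l < y -> y < rho l + t l -> (f l @` `]0, 1[) y.
  have /andP[rl0 _] := hrho l => ly yl.
  have x0 : 0 < (y - t l) / rho l by rewrite divr_gt0// subr_gt0.
  have x1 : (y - t l) / rho l < 1 by rewrite ltr_pdivrMr// mul1r ltrBlDr.
  exists ((y - t l) / rho l); first by rewrite /= in_itv/= x0 x1.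
  by rewrite hf ?(ltW x0) ?(ltW x1)// mulrC divfK ?subrK// gt_eqF.
have : (f i @` `]0, 1[ `&` f j @` `]0, 1[) y.
  by split; apply: mem => //; lra.
by rewrite hdisj// neq_ltn ij.
Qed.

(** The theorem when p has the larger partial sums, so that nu lies to the
right of mu. *)
Lemma wasserstein1_dominated (R : realType) (k : nat) (rho t : 'I_k -> R)
    (f : 'I_k -> R -> R) (p q : 'I_k -> R) (mu nu : probability R R)
    (hrho : forall i, 0 < rho i < 1)
    (ht : forall i, 0 <= t i < 1)
    (hf01 : forall i, set_fun `[0, 1]%classic `[0, 1]%classic (f i))
    (hf : forall i x, 0 <= x <= 1 -> f i x = rho i * x + t i)
    (sep : forall i j : 'I_k, (i < j)%N -> rho i + t i <= t j)
    (hp : prob_vector p) (hq : prob_vector q)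
    (qp : forall m : nat, psum q m <= psum p m)
    (hmu : stationary f p mu) (hnu : stationary f q nu) :
  wasserstein1 mu nu =
    (`| (\sum_(i < k) p i * t i) / (1 - \sum_(i < k) p i * rho i)
      - (\sum_(i < k) q i * t i) / (1 - \sum_(i < k) q i * rho i) |)%:E.
Proof.
have ma := absmoment_stationary hrho ht hf01 hf hp hmu.
have nb := absmoment_stationary hrho ht hf01 hf hq hnu.
move: ma nb; set a := (X in X%:E); set b := (X in _ -> _ = X%:E -> _) => ma nb.
apply/eqP; rewrite eq_le; apply/andP; split; last first.
  have [ab|ab] := leP (a - b) 0.
    by rewrite ler0_norm// opprB; apply: wasserstein1_ge.
  by rewrite gtr0_norm// wasserstein1_sym; apply: wasserstein1_ge.
apply: (@le_trans _ _ (b - a)%:E); last first.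
  by rewrite lee_fin distrC ler_norm.
apply/lee_addgt0Pr => e e0.
have r0 : 0 <= \sum_i p i * rho i.
  apply: sumr_ge0 => i _; have /andP[ri _] := hrho i.
  by rewrite mulr_ge0 ?(ltW ri)//; exact: hp.1.
have [n rn] : exists n, (\sum_i p i * rho i) ^+ n < e / 4.
  have e4 : 0 < e / 4 by rewrite divr_gt0.
  have : `|\sum_i p i * rho i| < 1.
    by rewrite ger0_norm//; exact: mean_ratio_lt1.
  move=> /cvg_expr/cvgr0Pnorm_lt/(_ _ e4)[n _ /(_ n (leqnn n))] /=.
  by rewrite ger0_norm ?exprn_ge0// => ?; exists n.
have [g gc gle] := small_excess_coupling hrho hf01 hf hp hq hmu hnu qp sep n.
have [g1 g2] := gc.
apply: (@le_trans _ _ 'E_g[fun z => `|z.1 - z.2|%R]%E).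
  apply: ereal_inf_lbound.
  by exists _, _, g, (fst : {RV g >-> R}), (snd : {RV g >-> R}).
have := coupling_excess hmu.1 hnu.1 gc.
rewrite ma nb -leeBrDr// => /le_trans; apply.
apply: (@le_trans _ _
  (b%:E + 2%:E * (2 * (\sum_i p i * rho i) ^+ n)%:E - a%:E)%E).
  by rewrite leeB// leeD2l// lee_wpmul2l// lee_fin.
rewrite -EFinM -!EFinD lee_fin; lra.
Qed.

Theorem corollary2p7 (R : realType) (k : nat) (rho t : 'I_k -> R)
    (f : 'I_k -> R -> R) (p q : 'I_k -> R)
    (mu nu : probability R R)
    (hrho : forall i, 0 < rho i < 1)
    (ht : forall i, 0 <= t i < 1)
    (hf01 : forall i, set_fun `[0, 1]%classic `[0, 1]%classic (f i))
    (hf : forall i x, 0 <= x <= 1 -> f i x = rho i * x + t i)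
    (hord : forall i j : 'I_k, (j : nat) = i.+1 ->
      Num.max (f i 0) (f i 1) <= Num.max (f j 0) (f j 1))
    (hdisj : forall i j : 'I_k, i != j ->
      f i @` `]0, 1[%classic `&` f j @` `]0, 1[%classic = set0)
    (hp : prob_vector p) (hp01 : forall i, 0 < p i < 1)
    (hq : prob_vector q) (hq01 : forall i, 0 < q i < 1)
    (hpq : (forall m : nat, (1 <= m <= k)%N ->
              0 <= \sum_(i < k | (i < m)%N) (p i - q i)) \/
           (forall m : nat, (1 <= m <= k)%N ->
              \sum_(i < k | (i < m)%N) (p i - q i) <= 0))
    (hmu : stationary f p mu) (hnu : stationary f q nu) :
  wasserstein1 mu nu =
    (`| (\sum_(i < k) p i * t i) / (1 - \sum_(i < k) p i * rho i)
      - (\sum_(i < k) q i * t i) / (1 - \sum_(i < k) q i * rho i) |)%:E.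
Proof.
have sep := affine_images_separated hrho hf hord hdisj.
have psum_le (u v : 'I_k -> R) : \sum_i u i = 1 -> \sum_i v i = 1 ->
    (forall m : nat, (1 <= m <= k)%N -> psum v m <= psum u m) ->
    forall m, psum v m <= psum u m.
  move=> u1 v1 vu m; have [km|mk] := ltnP k m.
    have psum_ge (s : 'I_k -> R) : psum s m = \sum_i s i.
      by apply: eq_bigl => i; rewrite (ltn_trans (ltn_ord i) km).
    by rewrite !psum_ge u1 v1.
  by case: m mk => [|m] mk; [rewrite !psum0 | apply: vu].
case: hpq => h.
  apply: (wasserstein1_dominated hrho ht hf01 hf sep) => //.
  apply: psum_le hp.2 hq.2 _ => m mk.
  by rewrite -subr_ge0 -sumrB; exact: h.
rewrite wasserstein1_sym distrC.
apply: (wasserstein1_dominated hrho ht hf01 hf sep) => //.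
apply: psum_le hq.2 hp.2 _ => m mk.
by rewrite -subr_le0 -sumrB; exact: h.
Qed.
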